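(* In the reset-button collector with equal standard probabilities $p_{i,n}=q_n/n$ for $1\le i\le n$, assume $\rho_nn\log n\to0$. Then for every $y\in\mathbb R$, $\mathbb P(T_n\le n\log n+ny)\to\exp(-e^{-y})$; equivalently $(T_n-n\log n)/n\Rightarrow G$ with $\mathbb P(G\le y)=\exp(-e^{-y})$.
   Context: Reset-button collector: fix $n\ge1$. There are standard coupons $1,\dots,n$ and a reset coupon. At each discrete time $t=1,2,\dots$ one coupon is sampled independently: the reset coupon with probability $\rho_n\in(0,1)$, standard coupon $i$ with probability $p_{i,n}$, where $\sum_ip_{i,n}=q_n:=1-\rho_n$. Starting from the empty collection, drawn standard coupons are added; a reset empties the collection and collecting continues. $T_n$ is the first time all $n$ standard coupons are present. *)

(* Defs.v *)
From HB Require Import structures.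
From mathcomp Require Import all_boot all_order all_algebra.
From mathcomp Require Import all_classical all_reals all_analysis.
Set Implicit Arguments. Unset Strict Implicit. Unset Printing Implicit Defensive.
Import Order.TTheory GRing.Theory Num.Theory.
Local Open Scope ring_scope.

(* A draw is [None] (the reset coupon) or [Some i] (standard coupon i : 'I_n). *)

Definition collected (n : nat) (w : seq (option 'I_n)) : {set 'I_n} :=
  foldl (fun (S : {set 'I_n}) c => match c with None => finset.set0 | Some i => i |: S end) finset.set0 w.

Definition draw_weight (R : realType) (n : nat) (rho : R) (p : 'I_n -> R)
  (c : option 'I_n) : R :=
  match c with None => rho | Some i => p i end.

(* P(T_n <= t) for t : nat : the probability, under i.i.d. draws, that at some
   time 1 <= s <= t the collection contains all n standard coupons.  This
   only depends on the first t draws, hence is a finite sum over t-tuples. *)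
Definition T_cdf_nat (R : realType) (n : nat) (rho : R) (p : 'I_n -> R)
  (t : nat) : R :=
  \sum_(w : t.-tuple (option 'I_n))
     (\prod_(c <- w) draw_weight rho p c) *
     ([exists s : 'I_t.+1, (0 < (s : nat))%N && (collected (take s w) == finset.setT)])%:R.

(* P(T_n <= x) for real x (T_n is a positive integer). *)
Definition T_cdf (R : realType) (n : nat) (rho : R) (p : 'I_n -> R) (x : R) : R :=
  if x < 0 then 0 else T_cdf_nat rho p (Num.truncn x).

Definition equal_probs (R : realType) (n : nat) (rho : R) : 'I_n -> R :=
  fun _ => (1 - rho) / n%:R.

(* Main.v *)
Require Import Defs.
From HB Require Import structures.
From mathcomp Require Import all_boot all_order all_algebra.
From mathcomp Require Import all_classical all_reals all_analysis.
From mathcomp Require Import ring lra.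
Import Order.TTheory GRing.Theory Num.Theory numFieldNormedType.Exports.
Local Open Scope classical_set_scope.
Local Open Scope ring_scope.

(** Let A be the event that the first t draws contain no reset and every
    standard coupon.  Then A implies T <= t, and T <= t without a reset among
    the first t draws implies A, so P(T <= t) lies between P(A) and
    P(A) + 1 - (1 - rho)^t.  By inclusion-exclusion P(A) is (1 - rho)^t times
    the classical coupon-collector probability
    sum_k (-1)^k 'C(n, k) (1 - k/n)^t.  For t = n ln n + n y + O(1) we have
    t rho -> 0, hence (1 - rho)^t -> 1, while the k-th term of the sum tends to
    (-1)^k e^(-ky) / k! and is dominated by e^(k(1-y)) / k!; Tannery's theorem
    then gives the limit exp(-e^(-y)). *)

(** * Words of draws, their weights, and covers without a reset *)

Lemma sum_tuple_prod (R : comPzSemiRingType) (T : finType) (t : nat)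
    (f : T -> R) :
  \sum_(w : t.-tuple T) \prod_(c <- w) f c = (\sum_c f c) ^+ t.
Proof.
rewrite -[in RHS](card_ord t) -prodr_const bigA_distr_bigA /=.
rewrite (reindex (fun g : {ffun 'I_t -> T} => [tuple g i | i < t])) /=.
  by apply: eq_bigr => g _; rewrite big_map big_enum.
exists (fun w : t.-tuple T => [ffun i => tnth w i]) => [g _|w _].
  by apply/ffunP => i; rewrite ffunE tnth_mktuple.
by apply: eq_from_tnth => i; rewrite tnth_mktuple ffunE.
Qed.

Lemma collected_rcons (n : nat) (w : seq (option 'I_n)) (c : option 'I_n) :
  collected (rcons w c) =
  if c is Some i then i |: collected w else finset.set0.
Proof. by rewrite /collected foldl_rcons. Qed.

Lemma collected_mem (n : nat) (w : seq (option 'I_n)) (i : 'I_n) :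
  i \in collected w -> Some i \in w.
Proof.
elim/last_ind: w => [|w [j|] IH]; rewrite ?collected_rcons ?inE //.
by rewrite mem_rcons inE => /orP[/eqP->|/IH->]; rewrite ?eqxx ?orbT.
Qed.

Lemma mem_collected (n : nat) (w : seq (option 'I_n)) (i : 'I_n) :
  None \notin w -> Some i \in w -> i \in collected w.
Proof.
elim/last_ind: w => [|w [j|] IH]; rewrite ?collected_rcons // !mem_rcons !inE //.
move=> /= nw /orP[/eqP[->]|/(IH nw)->]; by rewrite ?eqxx ?orbT.
Qed.

(** The event A. Unlike the event T <= t, it depends only on which values occur in [w], so
    inclusion-exclusion applies to it. *)
Definition direct_cover (n : nat) (w : seq (option 'I_n)) : bool :=
  (None \notin w) && [forall i : 'I_n, Some i \in w].

Lemma direct_cover_collected (n t : nat) (w : t.-tuple (option 'I_n)) :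
  (0 < n)%N -> direct_cover n w ->
  [exists s : 'I_t.+1,
     (0 < (s : nat))%N && (collected (take s w) == finset.setT)].
Proof.
move=> n0 /andP[nw /forallP iw].
(* The witness is s = t, which must be positive: since n > 0, a covering word is nonempty. *)
have t0 : (0 < t)%N.
  by rewrite -(size_tuple w); case: (val w) (iw (Ordinal n0)).
apply/existsP; exists ord_max; rewrite /= t0 take_oversize ?size_tuple //=.
by apply/eqP/setP => i; rewrite [RHS]inE mem_collected.
Qed.

Lemma collected_direct_cover (n t : nat) (w : t.-tuple (option 'I_n)) :
  [exists s : 'I_t.+1,
     (0 < (s : nat))%N && (collected (take s w) == finset.setT)] ->
  None \notin w -> direct_cover n w.
Proof.
move=> /existsP[s /andP[_ /eqP wT]] nw; rewrite /direct_cover nw /=.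
apply/forallP => i; apply: (@mem_take s); apply: collected_mem.
by rewrite wT inE.
Qed.

(** Giving weight 0 to every draw outside [P] absorbs the indicator into the product, and the sum
    over words factorises. *)
Lemma sum_draws_in (R : realType) (n t : nat) (rho : R) (p : 'I_n -> R)
    (P : pred (option 'I_n)) :
  \sum_(w : t.-tuple (option 'I_n))
     (\prod_(c <- w) draw_weight rho p c) * (all P w)%:R =
  (\sum_(c | P c) draw_weight rho p c) ^+ t.
Proof.
rewrite [in RHS]big_mkcond -sum_tuple_prod; apply: eq_bigr => w _.
have [wP|/allPn[c cw nPc]] := boolP (all P w).
  rewrite mulr1 big_seq [RHS]big_seq; apply: eq_bigr => c cw.
  by rewrite (allP wP).
rewrite mulr0; apply/esym/eqP; rewrite prodf_seq_eq0; apply/hasP.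
by exists c => //; rewrite (negPf nPc) eqxx.
Qed.

Lemma sum_equal_probs (R : realType) (n : nat) (rho : R) :
  (0 < n)%N -> rho + \sum_i @equal_probs R n rho i = 1.
Proof.
move=> n0; rewrite /equal_probs sumr_const card_ord -(mulr_natr (_ / _)) divfK ?pnatr_eq0 ?lt0n_neq0 //.
by rewrite addrC subrK.
Qed.

Lemma sum_option (R : pzRingType) (T : finType) (P : pred (option T))
    (f : option T -> R) :
  \sum_(c | P c) f c =
  (if P None then f None else 0) + \sum_(i | P (Some i)) f (Some i).
Proof.
rewrite big_mkcond [in RHS]big_mkcond (bigD1 None) //=; congr (_ + _).
rewrite (reindex_omap Some id) => [|[]//].
by apply: eq_bigl => i; rewrite eqxx.
Qed.

(** * Inclusion-exclusion and the two-sided bound on P(T <= t) *)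

Definition coupon_cdf (R : realType) (n t : nat) : R :=
  \sum_(k < n.+1) (-1) ^+ k * 'C(n, k)%:R * (1 - k%:R / n%:R) ^+ t.

(* Inclusion-exclusion over the set J of coupons missing from w. *)
Lemma direct_cover_prob (R : realType) (n t : nat) (rho : R) :
  (0 < n)%N ->
  \sum_(w : t.-tuple (option 'I_n))
     (\prod_(c <- w) draw_weight rho (@equal_probs R n rho) c) *
     (direct_cover n w)%:R =
  (1 - rho) ^+ t * coupon_cdf R n t.
Proof.
move=> n0.
pose Q (J : {set 'I_n}) (c : option 'I_n) :=
  if c is Some i then i \notin J else false.
have incl (w : t.-tuple (option 'I_n)) : (direct_cover n w)%:R =
    \sum_(J : {set 'I_n}) (-1) ^+ #|J| * (all (Q J) w)%:R :> R.
  (* The indicator that i occurs is 1 minus the indicator that it is missing; expanding the product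
     over i gives the sum over J. The no-reset factor is then absorbed into [Q J]. *)
  transitivity ((None \notin w)%:R *
      \prod_(i : 'I_n) ((- (Some i \notin w)%:R) + 1) : R).
    rewrite /direct_cover -mulnb natrM; congr (_ * _).
    have [/forallP iw|/forallPn[i iw]] := boolP [forall i, Some i \in w].
      by rewrite big1 // => i _; rewrite iw oppr0 add0r.
    by apply/esym/eqP/prodf_eq0; exists i => //; rewrite iw addNr.
  rewrite bigA_distr mulr_sumr; apply: eq_bigr => J _.
  rewrite -big_mkcond /=.
  have -> : \prod_(i in J) - (Some i \notin w)%:R =
      (-1) ^+ #|J| * \prod_(i in J) (Some i \notin w)%:R :> R.
    rewrite -prodr_const -big_split /=; apply: eq_bigr => i _.
    by rewrite mulN1r.
  rewrite mulrCA; congr (_ * _).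
  have [wQ|/allPn[c cw nQ]] := boolP (all (Q J) w).
    have /allP wQ' := wQ.
    rewrite big1 => [|i iJ].
      by rewrite mulr1; case: (boolP (None \in w)) => // /wQ'.
    by case: (boolP (Some i \in w)) => // /wQ' /=; rewrite iJ.
  case: c cw nQ => [i|] cw /=; last by rewrite cw mul0r.
  rewrite negbK => iJ; apply/eqP; rewrite mulf_eq0; apply/orP; right.
  by apply/prodf_eq0; exists i => //; rewrite cw.
under eq_bigr do rewrite incl mulr_sumr.
rewrite exchange_big /=.
have wJ (J : {set 'I_n}) :
    \sum_(c | Q J c) draw_weight rho (@equal_probs R n rho) c =
    (1 - rho) * (1 - #|J|%:R / n%:R) :> R.
  rewrite sum_option /= add0r /equal_probs sumr_const.
  have -> : #|[pred i | i \notin J]| = (n - #|J|)%N.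
    apply: (@addnI #|J|); rewrite subnKC; last first.
      by rewrite -[leqRHS](card_ord n) max_card.
    by rewrite -[RHS](card_ord n) -(cardC J); congr addn; apply: eq_card.
  rewrite -(mulr_natr (_ / _)) -mulrA natrB; last by rewrite -[leqRHS](card_ord n) max_card.
  by rewrite mulrBr mulVf ?pnatr_eq0 ?lt0n_neq0 // [_^-1 * _]mulrC.
transitivity (\sum_(J : {set 'I_n}) (1 - rho) ^+ t *
    ((-1) ^+ #|J| * (1 - #|J|%:R / n%:R) ^+ t)).
  apply: eq_bigr => J _; under eq_bigr do rewrite mulrCA.
  by rewrite -mulr_sumr sum_draws_in wJ exprMn mulrCA.
rewrite -mulr_sumr; congr (_ * _).
have cJ (J : {set 'I_n}) : (#|J| < n.+1)%N.
  by rewrite ltnS -[leqRHS](card_ord n) max_card.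
(* The summand depends only on the size of J, so the sets are grouped by cardinality, with 'C(n, k)
   of them for each k. *)
rewrite (partition_big (fun J => Ordinal (cJ J)) xpredT) //=.
apply: eq_bigr => k _.
rewrite (eq_bigr (fun _ => (-1) ^+ k * (1 - k%:R / n%:R) ^+ t)).
  rewrite sumr_const -(mulr_natr (_ * _)) mulrAC; congr (_ * _%:R * _).
  transitivity 'C(#|'I_n|, k); last by rewrite card_ord.
  rewrite -card_draws.
  by apply: eq_card => J; rewrite !inE.
by move=> J /eqP <-.
Qed.

Lemma T_cdf_nat_bounds (R : realType) (n t : nat) (rho : R) :
  (0 < n)%N -> 0 < rho < 1 ->
  (1 - rho) ^+ t * coupon_cdf R n t <= T_cdf_nat rho (@equal_probs R n rho) t <=
  (1 - rho) ^+ t * coupon_cdf R n t + (1 - (1 - rho) ^+ t).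
Proof.
move=> n0 /andP[r0 r1].
have w0 (w : seq (option 'I_n)) :
    0 <= \prod_(c <- w) draw_weight rho (@equal_probs R n rho) c.
  apply: prodr_ge0 => -[i|] _ /=; last exact: ltW.
  by rewrite divr_ge0 // subr_ge0 ltW.
rewrite -direct_cover_prob // /T_cdf_nat; apply/andP; split.
  apply: ler_sum => w _; apply: ler_wpM2l => //.
  rewrite ler_nat; have [/(direct_cover_collected _ _ _ n0)->//|//] :=
    boolP (direct_cover n w).
have tot : \sum_(w : t.-tuple (option 'I_n))
    \prod_(c <- w) draw_weight rho (@equal_probs R n rho) c = 1.
  by rewrite sum_tuple_prod sum_option /= sum_equal_probs // expr1n.
have noreset : \sum_(w : t.-tuple (option 'I_n))
    (\prod_(c <- w) draw_weight rho (@equal_probs R n rho) c) *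
    (all isSome w)%:R = (1 - rho) ^+ t.
  rewrite sum_draws_in sum_option /= add0r.
  by rewrite -(sum_equal_probs _ _ rho n0) [rho + _]addrC addrK.
(* The error is written as the total weight of the words containing a reset, so that the bound can
   be checked word by word: without a reset T <= t forces A, and with one the error indicator is
   already 1. *)
have -> : 1 - (1 - rho) ^+ t = \sum_(w : t.-tuple (option 'I_n))
    (\prod_(c <- w) draw_weight rho (@equal_probs R n rho) c) *
    (1 - (all isSome w)%:R).
  rewrite -noreset -[X in X - _]tot -sumrB; apply: eq_bigr => w _.
  by rewrite mulrBr mulr1.
rewrite -big_split /=; apply: ler_sum => w _.
rewrite -mulrDr; apply: ler_wpM2l => //.
have -> : all isSome w = (None \notin w).
  by rewrite -has_pred1 -all_predC; apply: eq_all => -[].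
have [nw|nw] := boolP (None \in w); last first.
  rewrite subrr addr0 ler_nat.
  by case: existsP => // /existsP /collected_direct_cover ->.
rewrite subr0 -[leLHS]add0r lerD ?ler0n //.
by case: [exists _, _]; rewrite ?ler01.
Qed.

(** * Tannery's theorem, with a growing number of summands *)

Lemma tannery (R : realType) (f : nat -> nat -> R) (l g : nat -> R)
    (m : nat -> nat) (L : R) :
  cvgn (series g) -> (forall k, f ^~ k @ \oo --> l k) ->
  (\forall n \near \oo, forall k, `|f n k| <= g k) ->
  m n @[n --> \oo] --> \oo -> series l @ \oo --> L ->
  (fun n => \sum_(0 <= k < m n) f n k) @ \oo --> L.
Proof.
move=> cg cf fg cm cl.
have lg k : `|l k| <= g k.
  have cfk : `|f n k| @[n --> \oo] --> `|l k| by apply: cvg_norm; apply: cf.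
  apply: (@ler_cvg_to _ _ _ _ _ _ _ _ cfk (cvg_cst (g k))).
  by near=> n; near: n; apply: filterS fg => n; apply.
(* Since [series l (m n)] tends to [L], only the summed differences f - l matter. They are split at
   a fixed N: the finite head vanishes termwise, and the tail is at most twice the tail of [g]. *)
suff h0 : (fun n => \sum_(0 <= k < m n) (f n k - l k)) @ \oo --> (0 : R).
  have -> : (fun n => \sum_(0 <= k < m n) f n k) =
      (fun n => \sum_(0 <= k < m n) (f n k - l k) + series l (m n)).
    apply/funext => n; rewrite /series /= -big_split /=.
    by apply: eq_bigr => k _; rewrite subrK.
  rewrite -[L]add0r; apply: cvgD h0 _.
  exact: (@cvg_comp _ _ _ m (series l) _ _ _ cm cl).
apply/cvgr0Pnorm_lt => e e0.
(* The tail of [g] gets e/4 because it is counted twice, once for f and once for l; the head gets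
   the other e/2. *)
have e4 : 0 < e / 4 by rewrite divr_gt0.
have /cauchy_cvgP/cauchy_seriesP/(_ _ e4) := cg.
move=> [[A B] /= [[N1 _ HA] [N2 _ HB]] H].
pose N := maxn N1 N2.
have HN p : (N <= p)%N -> `|\sum_(N <= k < p) g k| < e / 4.
  move=> Np; apply: (H (N, p)); split => /=.
    by apply: HA; rewrite /= leq_maxl.
  by apply: HB => /=; rewrite (leq_trans _ Np) // leq_maxr.
have hN : (fun n => \sum_(0 <= k < N) `|f n k - l k|) @ \oo --> (0 : R).
  rewrite [X in _ --> X](_ : _ = \sum_(0 <= k < N) `|l k - l k|); last first.
    by rewrite big1 // => k _; rewrite subrr normr0.
  apply: (@cvg_big R nat +%R 0 xpredT (@add_continuous R) _ _ _
    (fun k n => `|f n k - l k|) (fun k => `|l k - l k|)) => k _.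
  by apply: cvg_norm; apply: cvgB (cf k) _; exact: cvg_cst.
have e2 : 0 < e / 2 by rewrite divr_gt0.
have /cvgr0Pnorm_lt/(_ _ e2) hN' := hN.
near=> n.
have Nm : (N <= m n)%N by near: n; exact: (cm _ (nbhs_infty_ge N)).
rewrite (big_cat_nat _ Nm) //=.
have h1 : \sum_(0 <= k < N) `|f n k - l k| < e / 2.
  by apply: le_lt_trans (ler_norm _) _; near: n; exact: hN'.
have h2 : `|\sum_(N <= k < m n) (f n k - l k)| <= 2 * \sum_(N <= k < m n) g k.
  apply: le_trans (ler_norm_sum _ _ _) _.
  rewrite mulr_sumr; apply: ler_sum => k _.
  apply: le_trans (ler_normB _ _) _; rewrite mulr_natl mulr2n lerD //.
  by move: k; near: n.
have h3 := HN _ Nm.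
have h4 := ler_norm (\sum_(N <= k < m n) g k).
have h5 := ler_norm_sum (index_iota 0 N) (fun k => f n k - l k) xpredT.
apply: le_lt_trans (ler_normD _ _) _.
lra.
Unshelve. all: by end_near. Qed.

(** * Elementary limits and estimates for the logarithm and the exponential *)

Section LnLimits.
Context {R : realType}.

Lemma cvg_ln_nat : ln (n%:R : R) @[n --> \oo] --> +oo.
Proof.
apply/cvgryPge => M; near=> n.
rewrite -[M]expRK ler_ln ?posrE ?expR_gt0 //; first by near: n; exact: nbhs_infty_ger.
by rewrite ltr0n; near: n; exact: nbhs_infty_gt.
Unshelve. all: by end_near. Qed.

Lemma cvg_ln_natV : (ln (n%:R : R))^-1 @[n --> \oo] --> (0 : R).
Proof.
apply/gtr0_cvgV0; last exact: cvg_ln_nat.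
near=> n; rewrite ln_gt0 // ltr1n; near: n; exact: nbhs_infty_gt.
Unshelve. all: by end_near. Qed.

Lemma cvg_natV : (n%:R : R)^-1 @[n --> \oo] --> (0 : R).
Proof.
apply/gtr0_cvgV0; last exact: cvgr_idn.
near=> n; rewrite ltr0n; near: n; exact: nbhs_infty_gt.
Unshelve. all: by end_near. Qed.

(** With l = ln n, the bound e^l >= 1 + l^2/2 gives l^2 <= 2n, that is l/n <= 2/l, which tends to
    0. *)
Lemma cvg_ln_nat_div : ln (n%:R : R) / n%:R @[n --> \oo] --> (0 : R).
Proof.
apply: (@squeeze_cvgr _ _ _ _ (fun=> 0) (fun n => 2 * (ln (n%:R : R))^-1)).
- near=> n.
  have n1 : (1 < n)%N by near: n; exact: nbhs_infty_gt.
  have n0 : 0 < (n%:R : R) by rewrite ltr0n ltnW.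
  have l0 : 0 < ln (n%:R : R) by rewrite ln_gt0 // ltr1n.
  rewrite divr_ge0 ?(ltW l0) ?(ltW n0) //= ler_pdivrMr // mulrAC ler_pdivlMr //.
  have := expR_ge1Dxn 1 (ltW l0); rewrite lnK ?posrE //.
  by rewrite -expr2 (_ : 2`! = 2)%N // => h; lra.
- exact: cvg_cst.
- by rewrite -(mulr0 2); apply: cvgM cvg_ln_natV; exact: cvg_cst.
Unshelve. all: by end_near. Qed.

End LnLimits.

(** A converse to 1 - x <= e^(-x), for lower bounds on powers of 1 - k/n. Take reciprocals in 1/(1 -
    x) = 1 + x/(1 - x) <= e^(x/(1 - x)). *)
Lemma expR_le_1B (R : realType) (x : R) : x < 1 -> expR (- (x / (1 - x))) <= 1 - x.
Proof.
move=> x1; have x0 : 0 < 1 - x by rewrite subr_gt0.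
rewrite expRN -[leRHS]invrK lef_pV2 ?posrE ?invr_gt0 ?expR_gt0 //.
apply: le_trans (expR_ge1Dx _).
by rewrite (_ : 1 + x / _ = (1 - x)^-1) //; field; rewrite lt0r_neq0.
Qed.

(** * Asymptotics of the classical coupon-collector sum *)

Section CouponTerm.
Context {R : realType}.
Implicit Types n k t : nat.

Definition coupon_term n k t : R := 'C(n, k)%:R * (1 - k%:R / n%:R) ^+ t.

Lemma coupon_term_ge0 n k t : 0 <= coupon_term n k t.
Proof.
rewrite /coupon_term; have [kn|nk] := leqP k n; last by rewrite bin_small ?mul0r.
case: n kn => [|n kn]; first by rewrite leqn0 => /eqP ->; rewrite mul0r subr0 expr1n mulr1.
by rewrite mulr_ge0 // exprn_ge0 // subr_ge0 ler_pdivrMr ?ltr0n // mul1r ler_nat.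
Qed.

Lemma ffact_le_exp n k : (n ^_ k <= n ^ k)%N.
Proof.
elim: k => // k IH; rewrite ffactnSr expnSr leq_mul //; exact: leq_subr.
Qed.

Lemma exp_le_ffact n k : ((n - k) ^ k <= n ^_ k)%N.
Proof.
(* The base n - k must stay fixed, so the induction runs on the exponent j alone; each factor n - i
   with i < k is at least n - k. *)
suff h j : (j <= k)%N -> ((n - k) ^ j <= n ^_ j)%N by exact: h.
elim: j => // j IH jk; rewrite ffactnSr expnSr.
by apply: leq_mul; [exact: IH (ltnW jk)|exact: leq_sub2l (ltnW jk)].
Qed.

Lemma bin_ffactR n k : 'C(n, k)%:R = (n ^_ k)%:R / k`!%:R :> R.
Proof. by rewrite -bin_ffact natrM mulfK // pnatr_eq0 -lt0n fact_gt0. Qed.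

(** Combines n^_k <= n^k with 1 - x <= e^(-x). The exponent is arranged around ln n - t/n, the
    quantity that tends to -y. *)
Lemma coupon_term_le n k t : (0 < n)%N ->
  coupon_term n k t <= expR (k%:R * (ln n%:R - t%:R / n%:R)) / k`!%:R.
Proof.
move=> n0; have nR : 0 < (n%:R : R) by rewrite ltr0n.
have [kn|nk] := leqP k n; last first.
  by rewrite /coupon_term bin_small // mul0r divr_ge0 ?expR_ge0.
have x0 : 0 <= 1 - (k%:R / n%:R : R).
  by rewrite subr_ge0 ler_pdivrMr // mul1r ler_nat.
rewrite /coupon_term bin_ffactR mulrAC ler_wpM2r ?invr_ge0 //.
rewrite mulrBr expRD expRM_natl lnK ?posrE //.
apply: ler_pM; rewrite ?exprn_ge0 //.
  by rewrite -natrX ler_nat ffact_le_exp.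
have -> : - (k%:R * (t%:R / n%:R)) = t%:R * (- (k%:R / n%:R)) :> R.
  by rewrite mulrN mulrCA.
rewrite expRM_natl lerXn2r ?nnegrE ?expR_ge0 //; exact: expR_ge1Dx.
Qed.

(* 'C(n, k) >= (n - k)^k / k! costs an extra factor (1 - k/n)^k, which is
   absorbed by replacing t with t + k. *)
Lemma coupon_term_ge n k t : (k < n)%N ->
  expR (k%:R * (ln n%:R - (t%:R + k%:R) / (n%:R - k%:R))) / k`!%:R
  <= coupon_term n k t.
Proof.
move=> kn; have n0 : (0 < n)%N by exact: leq_ltn_trans kn.
have nR : 0 < (n%:R : R) by rewrite ltr0n.
have nk0 : 0 < n%:R - k%:R :> R by rewrite subr_gt0 ltr_nat.
rewrite /coupon_term bin_ffactR mulrAC ler_wpM2r ?invr_ge0 //.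
have xE : 1 - k%:R / n%:R = (n%:R - k%:R) / n%:R :> R.
  by rewrite mulrBl divff ?lt0r_neq0.
have x1 : k%:R / n%:R < 1 :> R by rewrite ltr_pdivrMr // mul1r ltr_nat.
apply: (@le_trans _ _ (n%:R ^+ k * (1 - k%:R / n%:R) ^+ (k + t))); last first.
  rewrite exprD mulrA -exprMn xE mulrC [n%:R * _]mulrC divfK ?lt0r_neq0 // mulrC.
  rewrite ler_wpM2r ?exprn_ge0 ?divr_ge0 ?(ltW nk0) //.
  by rewrite -natrB 1?ltnW // -natrX ler_nat exp_le_ffact.
rewrite mulrBr expRD expRM_natl lnK ?posrE //.
rewrite ler_wpM2l ?exprn_ge0 //.
have -> : - (k%:R * ((t%:R + k%:R) / (n%:R - k%:R))) =
    (k + t)%:R * (- ((k%:R / n%:R) / (1 - k%:R / n%:R))) :> R.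
  rewrite xE natrD; field.
  by rewrite !lt0r_neq0.
rewrite expRM_natl lerXn2r ?nnegrE ?expR_ge0 ?subr_ge0 ?(ltW x1) //.
exact: expR_le_1B.
Qed.

Lemma coupon_term_cvg (t : nat -> nat) (y : R) k :
  ln (n%:R : R) - (t n)%:R / n%:R @[n --> \oo] --> - y ->
  coupon_term n k (t n) @[n --> \oo] --> expR (- y) ^+ k / k`!%:R.
Proof.
move=> ht; rewrite -expRM_natl.
apply: (@squeeze_cvgr _ _ _ _
  (fun n => expR (k%:R * (ln n%:R - ((t n)%:R + k%:R) / (n%:R - k%:R))) / k`!%:R)
  (fun n => expR (k%:R * (ln n%:R - (t n)%:R / n%:R)) / k`!%:R)).
- near=> n; have kn : (k < n)%N by near: n; exact: nbhs_infty_gt.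
  by rewrite coupon_term_ge // coupon_term_le // (leq_ltn_trans _ kn).
- apply: cvgM; last exact: cvg_cst.
  apply: continuous_cvg; first exact: continuous_expR.
  apply: cvgM; first exact: cvg_cst.
  (* The exponent of the lower bound, with 1 - k/n factored out of the denominator n - k, so that
     every piece has a known limit. *)
  have hk : (1 - k%:R * (n%:R : R)^-1)^-1 * ((ln (n%:R : R) - (t n)%:R / n%:R)
      - k%:R * (ln n%:R / n%:R) - k%:R * n%:R^-1) @[n --> \oo]
      --> (1 - k%:R * 0)^-1 * (- y - k%:R * 0 - k%:R * 0).
    apply: cvgM.
      apply: cvgV; first by rewrite mulr0 subr0 oner_neq0.
      apply: cvgB; first exact: cvg_cst.
      by apply: cvgM cvg_natV; exact: cvg_cst.
    apply: cvgB; last by apply: cvgM cvg_natV; exact: cvg_cst.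
    apply: cvgB => //.
    by apply: cvgM cvg_ln_nat_div; exact: cvg_cst.
  rewrite !(mulr0, subr0) invr1 mul1r in hk.
  apply: cvg_trans hk; apply: near_eq_cvg; near=> n.
  have kn : (k < n)%N by near: n; exact: nbhs_infty_gt.
  have nR : (n%:R : R) != 0 by rewrite pnatr_eq0 -lt0n (leq_ltn_trans _ kn).
  have nk : (n%:R - k%:R : R) != 0 by rewrite lt0r_neq0 // subr_gt0 ltr_nat.
  by field; rewrite nR nk.
- apply: cvgM; last exact: cvg_cst.
  apply: continuous_cvg; first exact: continuous_expR.
  by apply: cvgM => //; exact: cvg_cst.
Unshelve. all: by end_near. Qed.

Lemma coupon_cdf_cvg (t : nat -> nat) (y : R) :
  ln (n%:R : R) - (t n)%:R / n%:R @[n --> \oo] --> - y ->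
  coupon_cdf R n (t n) @[n --> \oo] --> expR (- expR (- y)).
Proof.
move=> ht.
have -> : (fun n => coupon_cdf R n (t n)) = (fun n =>
    \sum_(0 <= k < n.+1) (-1) ^+ k * coupon_term n k (t n)).
  apply/funext => n; rewrite /coupon_cdf big_mkord.
  by apply: eq_bigr => k _; rewrite /coupon_term mulrA.
(* The limit series is the exponential series at -e^(-y). The dominating one is the series at
   e^(1-y): the added 1 is slack, since ln n - t/n tends to -y and so is eventually at most 1 - y,
   uniformly in k. *)
apply: (@tannery _ _ (exp_coeff (- expR (- y))) (exp_coeff (expR (1 - y)))).
- exact: is_cvg_series_exp_coeff.
- move=> k; rewrite /exp_coeff /= [(- expR _) ^+ _]exprNn -mulrA; apply: cvgM; first exact: cvg_cst.
  exact: coupon_term_cvg.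
- near=> n => k; rewrite normrM normrX normrN1 expr1n mul1r.
  rewrite ger0_norm ?coupon_term_ge0 //.
  have n0 : (0 < n)%N by near: n; exact: nbhs_infty_gt.
  apply: le_trans (coupon_term_le _ _ _ n0) _.
  rewrite /exp_coeff /= -expRM_natl ler_wpM2r ?invr_ge0 // ler_expR ler_wpM2l //.
  near: n; apply: (cvgr_le _ ht); lra.
- exact: (cvg_addnl 1).
- exact: is_cvg_series_exp_coeff.
Unshelve. all: by end_near. Qed.

End CouponTerm.

(** * Bernoulli's inequality and the limit law *)

Lemma bernoulli_ineq (R : realDomainType) (x : R) (t : nat) :
  0 <= x <= 1 -> 1 - t%:R * x <= (1 - x) ^+ t.
Proof.
move=> /andP[x0 x1]; elim: t => [|t IH]; first by rewrite mul0r subr0.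
rewrite exprS; have x1' : 0 <= 1 - x by rewrite subr_ge0.
apply: le_trans (ler_wpM2l x1' IH).
rewrite -natr1 -subr_ge0.
have -> : (1 - x) * (1 - t%:R * x) - (1 - (t%:R + 1) * x) = t%:R * (x * x) by ring.
by rewrite mulr_ge0 // mulr_ge0.
Qed.

Theorem mainTheorem11 (R : realType) (rho : nat -> R)
  (hrho : forall n, 0 < rho n < 1)
  (hlim : (fun n : nat => rho n * n%:R * ln (n%:R : R)) @ \oo --> (0 : R^o)) :
  forall y : R,
    (fun n : nat => @T_cdf R n (rho n) (@equal_probs R n (rho n))
                      (n%:R * ln (n%:R : R) + n%:R * y))
      @ \oo --> expR (- expR (- y)).
Proof.
move=> y.
pose x n : R := n%:R * ln n%:R + n%:R * y.
pose t n := Num.truncn (x n).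
(* Once ln n >= -y, the zero branch of [T_cdf] is avoided and truncation gives t <= x < t + 1. *)
have x_ge0 : \forall n \near \oo, 0 <= x n.
  near=> n; rewrite /x -mulrDr mulr_ge0 // -lerBlDr sub0r.
  near: n; have /cvgryPge := @cvg_ln_nat R; exact.
(* Here ln n - t/n = (x - t)/n - y, and the rounding error (x - t)/n lies between 0 and 1/n. *)
have ht : ln (n%:R : R) - (t n)%:R / n%:R @[n --> \oo] --> - y.
  apply: (@squeeze_cvgr _ _ _ _ (fun=> - y) (fun n => - y + (n%:R : R)^-1)).
  - near=> n.
    have n0 : 0 < (n%:R : R) by rewrite ltr0n; near: n; exact: nbhs_infty_gt.
    have xn : 0 <= x n by near: n.
    have /andP[] := truncn_itv xn; rewrite -/(t n) -natr1 => h1 h2.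
    have -> : ln n%:R - (t n)%:R / n%:R = (x n - (t n)%:R) / n%:R - y.
      by rewrite /x; field; rewrite lt0r_neq0.
    rewrite lerDr [- y + _]addrC lerD2r divr_ge0 ?subr_ge0 ?(ltW n0) //=.
    rewrite ler_pdivrMr // mulVf ?lt0r_neq0 //; lra.
  - exact: cvg_cst.
  - rewrite -[X in _ --> X]addr0; apply: cvgD cvg_natV; exact: cvg_cst.
have hrn : rho n * n%:R @[n --> \oo] --> (0 : R).
  have H : rho n * n%:R * ln n%:R * (ln n%:R)^-1 @[n --> \oo] --> (0 : R).
    by rewrite -[X in _ --> X](mulr0 0); exact: cvgM hlim cvg_ln_natV.
  apply: cvg_trans H; apply: near_eq_cvg; near=> n; rewrite /= mulfK // lt0r_neq0 // ln_gt0 // ltr1n.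
  near: n; exact: nbhs_infty_gt.
have htr : 1 - (t n)%:R * rho n @[n --> \oo] --> (1 : R).
  rewrite -[X in _ --> X]subr0; apply: cvgB; first exact: cvg_cst.
  (* This difference equals t rho: the first term vanishes by hypothesis, the second is [rho n * n],
     which tends to 0, times a convergent factor. *)
  have H : rho n * n%:R * ln n%:R
      - rho n * n%:R * (ln n%:R - (t n)%:R / n%:R) @[n --> \oo] --> (0 : R).
    rewrite -[X in _ --> X](subr0 0) -[X in _ --> _ - X](mul0r (- y)).
    exact: cvgB hlim (cvgM hrn ht).
  apply: cvg_trans H; apply: near_eq_cvg.
  near=> n; have n0 : (n%:R : R) != 0.
    by rewrite pnatr_eq0 -lt0n; near: n; exact: nbhs_infty_gt.
  by rewrite /=; field.
(* Bernoulli's inequality squeezes the no-reset probability between 1 - t rho and 1. *)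
have hq : (1 - rho n) ^+ t n @[n --> \oo] --> (1 : R).
  apply: (@squeeze_cvgr _ _ _ _ (fun n => 1 - (t n)%:R * rho n) (fun=> 1))
    => //; last exact: cvg_cst.
  near=> n.
  have /andP[r0 r1] := hrho n.
  rewrite bernoulli_ineq ?(ltW r0) ?(ltW r1) //=.
  by rewrite exprn_ile1 ?subr_ge0 ?(ltW r1) // lerBlDr lerDl ltW.
have hP := coupon_cdf_cvg _ _ ht.
pose u n := (1 - rho n) ^+ t n * coupon_cdf R n (t n).
have hu : u n @[n --> \oo] --> expR (- expR (- y)).
  by rewrite -[X in _ --> X]mul1r; exact: cvgM hq hP.
apply: (@squeeze_cvgr _ _ _ _ u (fun n => u n + (1 - (1 - rho n) ^+ t n))) => //.
  near=> n.
  rewrite /T_cdf -/(x n) -/(t n) ltNge.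
  have -> /= : 0 <= x n by near: n.
  apply: T_cdf_nat_bounds => //; near: n; exact: nbhs_infty_gt.
rewrite -[X in _ --> X]addr0; apply: cvgD => //.
by rewrite -[X in _ --> X](subrr 1); apply: cvgB => //; exact: cvg_cst.
Unshelve. all: by end_near. Qed.
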